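(* Let $A\subseteq\mathbf{R}$ and let $f:A\times A\to\mathbf{R}$ be a factorable double function. If $f$ is uniformly continuous on $A\times A$, then $f$ preserves factorable slowly oscillating double sequences from $A\times A$; that is, for every factorable slowly oscillating double sequence $\{x_{k,l}\}$ of points of $A\times A$, the double sequence $\{f(x_{k,l})\}$ of real numbers is slowly oscillating.
   Context: A double sequence is a family $\{x_{k,l}\}$ indexed by pairs of positive integers $k,l$. Write $|\cdot|$ for the absolute value on $\mathbf{R}$ and for the Euclidean norm on $\mathbf{R}^2$. A double sequence $\{x_{k,l}\}$ of points of $\mathbf{R}$ (or of $\mathbf{R}^2$) is slowly oscillating if for every $\varepsilon>0$ there exist $\alpha=\alpha(\varepsilon)>0$, $\delta=\delta(\varepsilon)>0$ and a positive integer $N=N(\varepsilon)$ such that $|x_{k,l}-x_{s,t}|<\varepsilon$ for all positive integers $k,l,s,t$ with $k,l\ge N$, $k\le s\le(1+\alpha)k$ and $l\le t\le(1+\delta)l$. A function $f:A\times A\to\mathbf{R}$ is a factorable double function if there are functions $g,h:A\to\mathbf{R}$ with $f(x,y)=g(x)h(y)$ for all $x,y\in A$. A double sequence $\{x_{k,l}\}$ of points of $A\times A$ is factorable if there are single sequences $(a_k)$, $(b_l)$ in $A$ with $x_{k,l}=(a_k,b_l)$ for all $k,l$. Uniform continuity is with respect to the Euclidean distance on $\mathbf{R}^2$. *)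

(* Defs.v *)
From Stdlib Require Import Reals.
From Coquelicot Require Import Coquelicot.

Open Scope R_scope.

(* Coquelicot's norm on a product of normed modules is the l2 one, so [norm] is
   the absolute value on R and the Euclidean norm on R * R. *)
Lemma norm_R_abs (x : R) : norm x = Rabs x.
Proof. reflexivity. Qed.

Lemma norm_R2_euclidean (p : R * R) : norm p = sqrt (fst p ^ 2 + snd p ^ 2).
Proof.
  change (sqrt (Rabs (fst p) ^ 2 + Rabs (snd p) ^ 2) = sqrt (fst p ^ 2 + snd p ^ 2)).
  now rewrite !pow2_abs.
Qed.

Definition square (A : R -> Prop) (p : R * R) : Prop := A (fst p) /\ A (snd p).

(* Indices are of type [positive], so a double sequence has no junk values at 0;
   [IPR] embeds [positive] in R. *)
Definition slowly_oscillating {V : NormedModule R_AbsRing}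
    (x : positive -> positive -> V) : Prop :=
  forall eps : R, 0 < eps ->
  exists alpha delta : R, exists N : positive,
    0 < alpha /\ 0 < delta /\
    forall k l s t : positive,
      (N <= k)%positive -> (N <= l)%positive ->
      (k <= s)%positive -> IPR s <= (1 + alpha) * IPR k ->
      (l <= t)%positive -> IPR t <= (1 + delta) * IPR l ->
      norm (minus (x k l) (x s t)) < eps.

(* A function on A x A is represented by a total function on R * R of which only
   the values on A x A matter. *)
Definition factorable_fun (A : R -> Prop) (f : R * R -> R) : Prop :=
  exists g h : R -> R, forall x y : R, A x -> A y -> f (x, y) = g x * h y.

Definition factorable_seq (A : R -> Prop) (x : positive -> positive -> R * R) : Prop :=
  exists a b : positive -> R,
    (forall k, A (a k)) /\ (forall l, A (b l)) /\
    forall k l, x k l = (a k, b l).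

Definition uniformly_continuous_on {V W : NormedModule R_AbsRing}
    (D : V -> Prop) (f : V -> W) : Prop :=
  forall eps : R, 0 < eps ->
  exists delta : R, 0 < delta /\
    forall p q : V, D p -> D q ->
      norm (minus p q) < delta -> norm (minus (f p) (f q)) < eps.

Definition preserves_factorable_slowly_oscillating
    (A : R -> Prop) (f : R * R -> R) : Prop :=
  forall x : positive -> positive -> R * R,
    (forall k l, square A (x k l)) ->
    factorable_seq A x ->
    slowly_oscillating x ->
    slowly_oscillating (fun k l => f (x k l)).

(* Main.v *)
Require Import Defs.
From Stdlib Require Import Reals.
From Coquelicot Require Import Coquelicot.

(** Moduli compose: uniform continuity turns [eps] into a distance [eta], and slow oscillation of
    [x] at tolerance [eta] keeps the relevant terms within [eta], so their images are within
    [eps]. *)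

Theorem theorem3p1 (A : R -> Prop) (f : R * R -> R) :
  factorable_fun A f ->
  uniformly_continuous_on (square A) f ->
  preserves_factorable_slowly_oscillating A f.
Proof.
  intros _ f_uc x x_in _ x_so eps eps_pos.
  destruct (f_uc eps eps_pos) as [eta [eta_pos f_eta]].
  destruct (x_so eta eta_pos)
    as [alpha [delta [N [alpha_pos [delta_pos x_eta]]]]].
  (* The index window of [x] at tolerance [eta] serves unchanged for the image at tolerance [eps];
     [delta] is the window ratio in the second index, while [eta] is the continuity modulus. *)
  exists alpha, delta, N.
  repeat split; trivial.
  intros k l s t Nk Nl ks s_le lt t_le.
  apply f_eta; [apply x_in | apply x_in | now apply x_eta].
Qed.
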